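(* Let $k,n,m\ge 1$ be integers and, for each $i\in[k]$, let $\mathcal X^{(i)}\subseteq\mathbb R^n$ be a closed (possibly nonconvex) set, $c^{(i)}\in\mathbb R^n$, $B^{(i)}\in\mathbb R^{m\times n}$, and let $b\in\mathbb R^m$. With $\mathrm{OPT}(\cdot)$, $\mathrm{DUAL}(\cdot)$, $\mathrm{OPT}_{\mathbf L}(\cdot)$, $\mathcal P$ and $\Phi$ as defined in the context, assume that $\mathrm{OPT}_{\mathbf L}(b)=\mathrm{DUAL}(b)$ and that $\mathrm{conv}(\mathcal X^{(i)})$ is closed for all $i\in[k]$. Let $\mathcal E:=\Phi(\mathcal P)$. Then $$\mathrm{OPT}(b+\mathcal E\mathbf 1)-\mathcal E\;\le\;\mathrm{DUAL}(b)\;\le\;\mathrm{OPT}(b),$$ and therefore the duality gap $\Delta:=\mathrm{OPT}(b)-\mathrm{DUAL}(b)$ satisfies $$\Delta\le \mathcal E+\mathrm{OPT}(b)-\mathrm{OPT}(b+\mathcal E\mathbf 1).$$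
   Context: Notation: $[k]=\{1,\dots,k\}$; $\mathbf 1\in\mathbb R^m$ is the all-ones vector; sums of sets are Minkowski sums; $\mathrm{conv}$ is the convex hull and $\overline{\mathrm{conv}}$ its closure; $\mathcal B(0,1)$ is the closed Euclidean unit ball. Primal problem: for $b\in\mathbb R^m$, $$\mathrm{OPT}(b):=\inf\Big\{\sum_{i=1}^k\langle c^{(i)},x^{(i)}\rangle:\ \sum_{i=1}^k B^{(i)}x^{(i)}\le b,\ x^{(i)}\in\mathcal X^{(i)}\ \forall i\in[k]\Big\}.$$ Lagrangian dual: for $\lambda\in\mathbb R^m$, $\lambda\ge0$, $$L(\lambda):=\inf\Big\{\sum_{i=1}^k\big(\langle c^{(i)},x^{(i)}\rangle+\langle\lambda,B^{(i)}x^{(i)}\rangle\big)-\langle\lambda,b\rangle:\ x^{(i)}\in\mathcal X^{(i)}\ \forall i\in[k]\Big\},\qquad \mathrm{DUAL}(b):=\sup_{\lambda\ge0}L(\lambda).$$ Convexified primal: $$\mathrm{OPT}_{\mathbf L}(b):=\inf\Big\{\sum_{i=1}^k\langle c^{(i)},x^{(i)}\rangle:\ \sum_{i=1}^k B^{(i)}x^{(i)}\le b,\ x^{(i)}\in\overline{\mathrm{conv}}(\mathcal X^{(i)})\ \forall i\in[k]\Big\}.$$ Image sets: $\mathcal P^{(i)}:=\{(\langle c^{(i)},x\rangle,\,B^{(i)}x):x\in\mathcal X^{(i)}\}\subseteq\mathbb R^{m+1}$ and $\mathcal P:=\sum_{i=1}^k\mathcal P^{(i)}$. Nonconvexity measure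 (Hausdorff distance from the convex hull): for $A\subseteq\mathbb R^d$, $\Phi(A):=\inf\{r\ge0:\mathrm{conv}(A)\subseteq A+r\,\mathcal B(0,1)\}$.
   Formalization: It is additionally assumed that E = Φ(P) is finite and that the infimum defining Φ(P) is attained, i.e. conv(P) ⊆ P + E·B(0,1) (automatic for finite E when P is closed); without attainment the claim can fail. *)

(* Defs.v *)
From HB Require Import structures.
From mathcomp Require Import all_boot all_order all_algebra.
From mathcomp Require Import all_classical all_reals all_analysis.
Import Order.TTheory GRing.Theory Num.Theory.
Import numFieldNormedType.Exports.

Set Implicit Arguments.
Unset Strict Implicit.
Unset Printing Implicit Defensive.

Local Open Scope classical_set_scope.
Local Open Scope ring_scope.

Section Euclidean.
Variable R : realType.

Definition dot (d : nat) (u v : 'cV[R]_d) : R := \sum_(j < d) u j 0 * v j 0.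

(* The library norm on matrices is the sup norm, so the Euclidean norm is
   introduced separately; both induce the topology of 'cV[R]_d. *)
Definition enorm (d : nat) (u : 'cV[R]_d) : R := Num.sqrt (dot u u).

Definition eball (d : nat) : set 'cV[R]_d := [set u | enorm u <= 1].

Definition lecol (d : nat) (u v : 'cV[R]_d) : Prop :=
  forall j : 'I_d, u j 0 <= v j 0.

Definition ones (d : nat) : 'cV[R]_d := const_mx 1.

Definition convhull (d : nat) (A : set 'cV[R]_d) : set 'cV[R]_d :=
  smallest (@convex_set R 'cV[R]_d) A.

Definition msum (k d : nat) (A : 'I_k -> set 'cV[R]_d) : set 'cV[R]_d :=
  [set \sum_(i < k) a i | a in [set a : 'I_k -> 'cV[R]_d | forall i, A i (a i)]].

(* A + r B(0,1) *)
Definition fatten (d : nat) (A : set 'cV[R]_d) (r : R) : set 'cV[R]_d :=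
  [set a + r *: u | a in A & u in @eball d].

(* Extended-valued: +oo when conv A lies in no A + r B(0,1). *)
Definition Phi (d : nat) (A : set 'cV[R]_d) : \bar R :=
  ereal_inf [set r%:E | r in [set r : R | 0 <= r /\ convhull A `<=` fatten A r]].

End Euclidean.

Section Problem.
Variables (R : realType) (k n m : nat).
Variables (X : 'I_k -> set 'cV[R]_n) (c : 'I_k -> 'cV[R]_n).
Variable B : 'I_k -> 'M[R]_(m, n).

Definition OPT (b : 'cV[R]_m) : \bar R :=
  ereal_inf [set (\sum_(i < k) dot (c i) (x i))%:E | x in
    [set x : 'I_k -> 'cV[R]_n |
      lecol (\sum_(i < k) B i *m x i) b /\ forall i, X i (x i)]].

Definition Lagr (b l : 'cV[R]_m) : \bar R :=
  ereal_inf [set (\sum_(i < k) (dot (c i) (x i) + dot l (B i *m x i))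
                  - dot l b)%:E | x in
    [set x : 'I_k -> 'cV[R]_n | forall i, X i (x i)]].

Definition DUAL (b : 'cV[R]_m) : \bar R :=
  ereal_sup [set Lagr b l | l in [set l : 'cV[R]_m | lecol 0 l]].

Definition Pimg (i : 'I_k) : set 'cV[R]_(1 + m) :=
  [set col_mx (dot (c i) x)%:M (B i *m x) | x in X i].

Definition Pset : set 'cV[R]_(1 + m) := msum Pimg.

End Problem.

Definition OPT_L (R : realType) (k n m : nat) (X : 'I_k -> set 'cV[R]_n)
    (c : 'I_k -> 'cV[R]_n) (B : 'I_k -> 'M[R]_(m, n)) (b : 'cV[R]_m) : \bar R :=
  OPT (fun i => closure (convhull (X i))) c B b.

(* Main.v *)
(* A feasible point of the convexified problem has its image in
   conv P, because conv of a Minkowski sum contains the sum of the hulls and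
   commutes with linear maps.  Moving that image by at most E in Euclidean norm
   lands on a point of P, i.e. on an image of a point of the nonconvex problem:
   the constraint coordinates and the cost coordinate each change by at most E.
   Hence OPT(b + E 1) - E <= OPT_L(b) = DUAL(b); the rest is weak duality. *)
Require Import Defs.
From HB Require Import structures.
From mathcomp Require Import all_boot all_order all_algebra.
From mathcomp Require Import all_classical all_reals all_analysis.
From mathcomp Require Import lra.
Import Order.TTheory GRing.Theory Num.Theory.
Import numFieldNormedType.Exports.
Local Open Scope classical_set_scope.
Local Open Scope ring_scope.

Section ConvexHull.
Context {R : realType}.

Lemma convex_preimage_affine (p q : nat) (C : set 'cV[R]_q) (v : 'cV[R]_q)
    (M : 'M[R]_(q, p)) :
  convex_set C -> convex_set [set x | C (v + M *m x)].
Proof.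
move=> Cconv x y t; rewrite !inE /= => Cx Cy.
have := Cconv _ _ t (mem_set Cx) (mem_set Cy); rewrite inE.
congr C; rewrite /conv /= mulmxDr -!scalemxAr !scalerDr addrACA -scalerDl.
by rewrite unstable.add_onemK scale1r.
Qed.

(* The qualified name avoids the msum of MathComp-Analysis, a sum of measures. *)
Lemma convhull_sum_mulmx (k p q : nat) (M : 'I_k -> 'M[R]_(q, p))
    (A : 'I_k -> set 'cV[R]_p) (x : 'I_k -> 'cV[R]_p) :
  (forall i, convhull (A i) (x i)) ->
  convhull (Defs.msum (fun i => [set M i *m y | y in A i]))
    (\sum_i M i *m x i).
Proof.
move=> Ax C [Cconv sAC].
(* Points of A i are replaced by points of its hull one index at a time. *)
suff H j : forall z : 'I_k -> 'cV[R]_p,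
    (forall i : 'I_k, if (i < j)%N then convhull (A i) (z i) else A i (z i)) ->
    C (\sum_i M i *m z i).
  by apply: (H k) => i; rewrite ltn_ord.
elim: j => [|j IH] z Az.
  by apply: sAC; exists (fun i => M i *m z i) => //= i; exists (z i) => //; exact: (Az i).
(* Every index of ['I_k] is then below both [j] and [j.+1], so the two hypotheses on [z]
   coincide. *)
have [kj|jk] := leqP k j.
  apply: IH => i; move: (Az i).
  by rewrite ltnS (leq_trans (ltn_ord i) kj) (ltnW (leq_trans (ltn_ord i) kj)).
pose jo := Ordinal jk.
rewrite (bigD1 jo)//= addrC.
(* With the other blocks frozen, the values of block [jo] that land in [C] form a convex set. It
   contains [A jo] by [IH], hence the whole hull. *)
have /smallest_sub : convex_set
    [set w | C (\sum_(i | i != jo) M i *m z i + M jo *m w)].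
  exact: convex_preimage_affine.
apply; last by have := Az jo; rewrite /= ltnSn; exact.
move=> w Aw /=.
have -> : \sum_(i | i != jo) M i *m z i + M jo *m w =
    \sum_i M i *m (if i == jo then w else z i).
  rewrite [RHS](bigD1 jo)//= eqxx addrC; congr +%R.
  by apply: eq_bigr => i /negPf ->.
apply: IH => i; case: eqP => [->|/eqP ij]; first by rewrite ltnn.
by have := Az i; rewrite ltnS leq_eqVlt -[(i : nat) == j]/(i == jo) (negPf ij).
Qed.

Lemma enorm_coord (d : nat) (u : 'cV[R]_d) (j : 'I_d) : `|u j 0| <= enorm u.
Proof.
rewrite -sqrtr_sqr ler_wsqrtr // /dot (bigD1 j)//= expr2 lerDl.
by apply: sumr_ge0 => i _; rewrite -expr2 sqr_ge0.
Qed.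

Lemma dotE (d : nat) (u v : 'cV[R]_d) : u^T *m v = (dot u v)%:M.
Proof.
rewrite [LHS]mx11_scalar mxE; congr (_ %:M).
by apply: eq_bigr => j _; rewrite mxE.
Qed.

Lemma dot_suml (d k : nat) (u : 'cV[R]_d) (v : 'I_k -> 'cV[R]_d) :
  dot u (\sum_i v i) = \sum_i dot u (v i).
Proof.
rewrite /dot exchange_big /=; apply: eq_bigr => j _.
by rewrite summxE mulr_sumr.
Qed.

Lemma Phi_ge0 (d : nat) (A : set 'cV[R]_d) : (0 <= Phi A)%E.
Proof. by apply: le_ereal_inf_tmp => _ [r [r0 _] <-]; rewrite lee_fin. Qed.

End ConvexHull.

Section Duality.
Context {R : realType} {k n m : nat}.
Context {X : 'I_k -> set 'cV[R]_n} {c : 'I_k -> 'cV[R]_n}.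
Context {B : 'I_k -> 'M[R]_(m, n)}.

(** At a feasible [x] with [l >= 0], the penalty [dot l (\sum_i B i *m x i - b)] is nonpositive, so
    [x] itself bounds the Lagrangian infimum by its cost. *)
Lemma weak_duality (b : 'cV[R]_m) : (DUAL X c B b <= OPT X c B b)%E.
Proof.
apply: ge_ereal_sup => _ [l l0 <-].
apply: le_ereal_inf_tmp => _ [x [xb Xx] <-].
apply: ge_ereal_inf.
exists (\sum_(i < k) (dot (c i) (x i) + dot l (B i *m x i)) - dot l b)%:E.
  by exists x.
rewrite lee_fin big_split /= -dot_suml lerBlDr lerD2l.
apply: ler_sum => j _; apply: ler_wpM2l; last exact: xb.
by have := l0 j; rewrite mxE.
Qed.

Lemma OPT_homo (b b' : 'cV[R]_m) :
  lecol b b' -> (OPT X c B b' <= OPT X c B b)%E.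
Proof.
move=> bb'; apply: ereal_inf_le_tmp => _ [x [xb Xx] <-]; exists x => //.
by split => // j; apply: le_trans (xb j) (bb' j).
Qed.

(** Stacking [(c i)^T] on [B i] merges cost and constraints into one linear map, the form that
    [convhull_sum_mulmx] handles. *)
Lemma Pset_sum_mulmx :
  Pset X c B = Defs.msum (fun i => [set col_mx (c i)^T (B i) *m y | y in X i]).
Proof.
congr Defs.msum; apply/funext => i; rewrite /Pimg; congr image.
by apply/funext => x; rewrite mul_col_mx dotE.
Qed.

Lemma sum_col_mxE (x : 'I_k -> 'cV[R]_n) :
  \sum_i col_mx (c i)^T (B i) *m x i =
  col_mx (\sum_i dot (c i) (x i))%:M (\sum_i B i *m x i).
Proof.
rewrite raddf_sum /=.
elim/big_rec3 : _ => [|i y1 y2 y3 _ ->]; first by rewrite col_mx0.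
by rewrite mul_col_mx dotE add_col_mx.
Qed.

Lemma OPT_fatten_le (b : 'cV[R]_m) (E : R) : 0 <= E ->
  convhull (Pset X c B) `<=` fatten (Pset X c B) E ->
  (OPT X c B (b + E *: ones R m) - E%:E
     <= OPT (fun i => convhull (X i)) c B b)%E.
Proof.
move=> E0 hatt; apply: le_ereal_inf_tmp => _ [x [xb Xx] <-].
have /hatt : convhull (Pset X c B) (\sum_i col_mx (c i)^T (B i) *m x i).
  by rewrite Pset_sum_mulmx; exact: convhull_sum_mulmx.
rewrite Pset_sum_mulmx => -[_ [a Pa <-] [u u1]].
(* Choosing a preimage of each summand gives the candidate [y] for the nonconvex problem with
   right-hand side [b + E *: ones R m]. *)
have /choice[y Xy] : forall i, exists y, X i y /\ col_mx (c i)^T (B i) *m y = a i.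
  by move=> i; have [y Xy <-] := Pa i; exists y.
under eq_bigr do rewrite -(Xy _).2.
rewrite !sum_col_mxE => eq_yx.
have u_le j : `|E * u j 0| <= E.
  rewrite normrM ger0_norm // ler_piMr //.
  by apply: le_trans u1; exact: enorm_coord.
rewrite leeBlDr //; apply: ge_ereal_inf.
exists (\sum_(i < k) dot (c i) (y i))%:E.
  exists y => //; split => [j|i]; last by have [] := Xy i.
  (* Row [rshift 1 j] of the stacked vector is constraint [j]; row [lshift m ord0], used below, is
     the cost. *)
  have /matrixP/(_ (rshift 1 j) 0) := eq_yx.
  rewrite mxE !col_mxEd [X in _ + X]mxE => eqj.
  have := u_le (rshift 1 j); have := xb j.
  rewrite !mxE ler_norml => ? /andP[? ?]; lra.
rewrite -EFinD lee_fin.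
have /matrixP/(_ (lshift m ord0) 0) := eq_yx.
rewrite mxE !col_mxEu [X in _ + X]mxE !mxE eqxx !mulr1n => eq0.
have := u_le (lshift m ord0).
rewrite ler_norml => /andP[? ?]; lra.
Qed.

End Duality.

Theorem theorem3 (R : realType) (k n m : nat)
    (hk : (1 <= k)%N) (hn : (1 <= n)%N) (hm : (1 <= m)%N)
    (X : 'I_k -> set 'cV[R]_n) (c : 'I_k -> 'cV[R]_n)
    (B : 'I_k -> 'M[R]_(m, n)) (b : 'cV[R]_m)
    (hX : forall i, closed (X i))
    (hdual : OPT_L X c B b = DUAL X c B b)
    (hconv : forall i, closed (convhull (X i)))
    (E : R) (hE : Phi (Pset X c B) = E%:E)
    (* the infimum defining Phi is attained *)
    (hatt : convhull (Pset X c B) `<=` fatten (Pset X c B) E) :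
  ((OPT X c B (b + E *: ones R m) - E%:E <= DUAL X c B b)%E /\
   (DUAL X c B b <= OPT X c B b)%E) /\
  (OPT X c B b - DUAL X c B b
     <= E%:E + OPT X c B b - OPT X c B (b + E *: ones R m))%E.
Proof.
have E0 : 0 <= E by rewrite -lee_fin -hE; exact: Phi_ge0.
have lower : (OPT X c B (b + E *: ones R m) - E%:E <= DUAL X c B b)%E.
  rewrite -hdual /OPT_L.
  (* Closedness of the hulls turns the closures in [OPT_L] into plain hulls. *)
  have -> : (fun i => closure (convhull (X i))) = (fun i => convhull (X i)).
    by apply/funext => i; rewrite -(closure_id _).1.
  exact: OPT_fatten_le.
have upper : (DUAL X c B b <= OPT X c B b)%E := weak_duality b.
split; first by [].
have shift : (OPT X c B (b + E *: ones R m) <= OPT X c B b)%E.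
  by apply: OPT_homo => j; rewrite !mxE mulr1 lerDl.
(* Each value may be infinite, with [+oo - +oo] equal to [-oo]. When all three are finite, the claim
   is [lower] rearranged. *)
move: lower upper shift.
case: (DUAL X c B b) => [d| |]; case: (OPT X c B b) => [v| |];
  case: (OPT X c B _) => [w| |] //=; rewrite ?lee_fin ?leey //.
by move=> *; lra.
Qed.
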